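(* Let $\ell\in\mathcal{L}(\Delta_K,\mathcal{Y})$ be a loss function. Consider $n$ test instances, where instance $i\in\{1,\dots,n\}$ has a (first-order) prediction $\hat{\boldsymbol{\theta}}_i\in\Delta_K$, a ground-truth conditional label distribution $\boldsymbol{\theta}_i\in\Delta_K$, and a random label $y_i\sim\boldsymbol{\theta}_i$. For an ordering of the test instances given by a permutation $\pi$ of $\{1,\dots,n\}$, let the area under the loss-rejection curve be $$\mathrm{AULC}=\int_0^1\left(\frac{1}{\lfloor\alpha n\rfloor}\sum_{j=1}^{\lfloor\alpha n\rfloor}\ell\bigl(\hat{\boldsymbol{\theta}}_{\pi(j)},y_{\pi(j)}\bigr)\right)d\alpha .$$ Then the expected AULC (expectation over the randomness in the labels) is minimized by ordering the test instances in non-decreasing order of their (instance-wise) expected loss $\mathbb{E}_{y\sim\boldsymbol{\theta}_i}\bigl[\ell(\hat{\boldsymbol{\theta}}_i,y)\bigr]$, i.e. by a permutation $\pi$ with $$\mathbb{E}_{y\sim\boldsymbol{\theta}_{\pi(1)}}\bigl[\ell(\hat{\boldsymbol{\theta}}_{\pi(1)},y)\bigr]\le\mathbb{E}_{y\sim\boldsymbol{\theta}_{\pi(2)}}\bigl[\ell(\hat{\boldsymbol{\theta}}_{\pi(2)},y)\bigr]\le\dots\le\mathbb{E}_{y\sim\boldsymbol{\theta}_{\pi(n)}}\bigl[\ell(\hat{\boldsymbol{\theta}}_{\pi(n)},y)\bigr].$$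
   Context: $K\in\mathbb{N}$ is the number of classes, $\mathcal{Y}=\{1,\dots,K\}$ is the label space, and $\Delta_K$ is the $(K-1)$-simplex of probability vectors $(\theta_1,\dots,\theta_K)$, identified with the set of all probability measures on $\mathcal{Y}$. $\bar{\mathbb{R}}=\mathbb{R}\cup\{-\infty,+\infty\}$. $\mathcal{L}(\Delta_K,\mathcal{Y})$ is the space of loss functions $\ell:\Delta_K\times\mathcal{Y}\to\bar{\mathbb{R}}$ such that, for all $\hat{\boldsymbol{\theta}}\in\Delta_K$, the function $\ell(\hat{\boldsymbol{\theta}},\cdot)$ is measurable with respect to the power set $2^{\mathcal{Y}}$ and quasi-integrable with respect to all $\boldsymbol{\theta}\in\Delta_K$. The setting is selective prediction: the permutation $\pi$ orders the test instances (in practice, by an uncertainty measure), and for each level $\alpha\in[0,1]$ the average loss is taken over the first $\lfloor\alpha n\rfloor$ instances in this ordering. The AULC integrates this average loss over all levels. *)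

(* Defs.v *)
From HB Require Import structures.
From mathcomp Require Import all_boot all_order all_algebra all_fingroup.
From mathcomp Require Import all_classical all_reals all_analysis
  measurable_realfun.

Set Implicit Arguments.
Unset Strict Implicit.
Unset Printing Implicit Defensive.

Import Order.TTheory GRing.Theory Num.Theory.
Import numFieldNormedType.Exports.

Local Open Scope classical_set_scope.
Local Open Scope ring_scope.

(* There are K = m.+1 classes throughout: a measurableType is inhabited, so the
   (degenerate) case K = 0, in which the simplex is empty, is excluded. *)
Definition label (m : nat) : Type := 'I_m.+1.

HB.instance Definition _ (m : nat) := Finite.on (label m).
HB.instance Definition _ (m : nat) := isPointed.Build (label m) ord0.
HB.instance Definition _ (m : nat) :=
  @isMeasurable.Build default_measure_display (label m) discrete_measurable
    discrete_measurable0 discrete_measurableC discrete_measurableU.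

Record simplex (R : realType) (m : nat) := Simplex {
  simplex_val :> {ffun label m -> R};
  simplex_ge0 : forall k, 0 <= simplex_val k;
  simplex_sum1 : \sum_k simplex_val k = 1 }.

(* The probability measure on the labels with point masses theta k. *)
Definition label_prob (R : realType) (m : nat) (theta : simplex R m)
    (A : set (label m)) : \bar R :=
  (\sum_(k : label m) (theta k)%:E * \d_k A)%E.

Section label_prob_is_probability.
Context (R : realType) (m : nat) (theta : simplex R m).

Let label_prob0 : label_prob theta set0 = 0%E.
Proof. by rewrite /label_prob big1// => k _; rewrite measure0 mule0. Qed.

Let label_prob_ge0 A : (0 <= label_prob theta A)%E.
Proof.
apply: sume_ge0 => k _; apply: mule_ge0 => //.
by rewrite lee_fin simplex_ge0.
Qed.

Let label_prob_sigma_additive : semi_sigma_additive (label_prob theta).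
Proof.
pose mu (k : nat) : {measure set (label m) -> \bar R} :=
  mscale (NngNum (simplex_ge0 theta (inord k))) (dirac (inord k : label m)).
suff -> : label_prob theta = msum mu m.+1.
  exact: measure_semi_sigma_additive.
apply/funext => A; apply: eq_bigr => k _.
by rewrite /mu/= /mscale/= inord_val.
Qed.

HB.instance Definition _ := isMeasure.Build _ _ _ (label_prob theta)
  label_prob0 label_prob_ge0 label_prob_sigma_additive.

Let label_prob_setT : label_prob theta [set: label m] = 1%E.
Proof.
rewrite /label_prob; under eq_bigr do rewrite diracT mule1.
by rewrite sumEFin simplex_sum1.
Qed.

HB.instance Definition _ := Measure_isProbability.Build _ _ _
  (label_prob theta) label_prob_setT.

End label_prob_is_probability.

Definition quasi_integrable d (T : measurableType d) (R : realType)
    (mu : {measure set T -> \bar R}) (f : T -> \bar R) : Prop :=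
  (\int[mu]_x f^\+ x < +oo)%E \/ (\int[mu]_x f^\- x < +oo)%E.

Definition loss_function (R : realType) (m : nat)
    (l : simplex R m -> label m -> \bar R) : Prop :=
  forall thetah : simplex R m,
    measurable_fun [set: label m] (l thetah) /\
    forall theta : simplex R m, quasi_integrable (label_prob theta) (l thetah).

Definition expected_loss (R : realType) (m : nat)
    (l : simplex R m -> label m -> \bar R) (thetah theta : simplex R m)
  : \bar R := (\int[label_prob theta]_y l thetah y)%E.

(* The average loss over the first floor(a * n) instances, as an extended real:
   it is 0 when floor(a * n) = 0, since 0^-1 = 0, and (+oo) + (-oo) = -oo. *)
Definition selective_loss (R : realType) (m n : nat)
    (l : simplex R m -> label m -> \bar R)
    (thetah : 'I_n -> simplex R m) (y : 'I_n -> label m) (pi : 'S_n) (a : R)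
  : \bar R :=
  let N := Num.truncn (a * n%:R) in
  ((N%:R^-1)%:E * \sum_(j < n | (j < N)%N) l (thetah (pi j)) (y (pi j)))%E.

Definition AULC (R : realType) (m n : nat)
    (l : simplex R m -> label m -> \bar R)
    (thetah : 'I_n -> simplex R m) (y : 'I_n -> label m) (pi : 'S_n)
  : \bar R :=
  (\int[@lebesgue_measure R]_(a in `[0%R, 1%R]) selective_loss l thetah y pi a)%E.

(* The library's 'E_P[_] is for real-valued variables only; AULC may be infinite. *)
Definition expected_AULC d (Omega : measurableType d) (R : realType)
    (P : probability Omega R) (m n : nat)
    (l : simplex R m -> label m -> \bar R) (thetah : 'I_n -> simplex R m)
    (Y : 'I_n -> {RV P >-> label m}) (pi : 'S_n) : \bar R :=
  (\int[P]_w AULC l thetah (fun i => Y i w) pi)%E.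

(* Main.v *)
(* The number floor(a n) of accepted instances takes finitely many values, so the
   AULC is a combination, with nonnegative weights independent of the ordering,
   of the sums of the losses of the first N instances, for N = 0, ..., n. The
   labels range over a finite set too, so the expectation passes through these
   sums (without independence, and infinite losses being allowed), which turns
   the losses into expected losses. The non-decreasing ordering minimizes all
   the prefix sums at once. *)

Require Import Defs.
From HB Require Import structures.
From mathcomp Require Import all_boot all_order all_algebra all_fingroup.
From mathcomp Require Import all_classical all_reals all_analysis
  measurable_realfun.

Set Implicit Arguments.
Unset Strict Implicit.
Unset Printing Implicit Defensive.

Import Order.TTheory GRing.Theory Num.Theory.

Local Open Scope classical_set_scope.
Local Open Scope ring_scope.

(** Once the common part of [A] and [B] is split off, two differences of equal cardinality remain,
    and one constant separates the values of [f] on them. *)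
Lemma lee_sum_smallest (R : realType) (I : finType) (A B : {set I})
    (f : I -> \bar R) :
  #|A| = #|B| ->
  (forall a b, a \in A -> b \notin A -> (f a <= f b)%E) ->
  (\sum_(i in A) f i <= \sum_(i in B) f i)%E.
Proof.
move=> cardAB leAf.
rewrite (big_setID B) (big_setID A (A := B)) /= finset.setIC leeD2l//.
have cardD : #|(A :\: B)%SET| = #|(B :\: A)%SET|.
  by rewrite !cardsD cardAB finset.setIC.
(* If the differences are empty, [M] is the default -oo, but both sums are then empty too. *)
pose M := \big[maxe/-oo%E]_(i in (A :\: B)%SET) f i.
apply: (@le_trans _ _ (\sum_(i in (A :\: B)%SET) M)%E).
  by apply: lee_sum => i iAB; exact: le_bigmax_cond.
rewrite [leLHS](_ : _ = \sum_(i in (B :\: A)%SET) M)%E; last first.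
  by rewrite !big_const cardD.
apply: lee_sum => b; rewrite inE => /andP[bA _].
apply: bigmax_le => [|a]; first exact: leNye.
by rewrite inE => /andP[_ aA]; exact: leAf.
Qed.

Lemma lee_sum_prefix (R : realType) (n : nat) (e : 'I_n -> \bar R)
    (pi sigma : 'S_n) (N : nat) :
  (forall i j : 'I_n, (i <= j)%N -> (e (pi i) <= e (pi j))%E) ->
  (\sum_(j < n | (j < N)%N) e (pi j) <= \sum_(j < n | (j < N)%N) e (sigma j))%E.
Proof.
move=> epi; pose J := finset (fun j : 'I_n => (j < N)%N).
have sumJ (s : 'S_n) :
    (\sum_(j < n | (j < N)%N) e (s j) = \sum_(i in s @: J) e i)%E.
  rewrite big_imset/=; last by move=> i j _ _; exact: perm_inj.
  by apply: eq_bigl => j; rewrite inE.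
rewrite !sumJ; apply: lee_sum_smallest.
  by rewrite !card_imset//; exact: perm_inj.
move=> _ b /imsetP[i + ->] bJ; rewrite inE => iN.
(* Since [b] is outside the image of [J], its position under [pi] is at least [N], hence after
   [i]. *)
rewrite -(permKV pi b); apply: epi; rewrite (leq_trans (ltnW iN))// leqNgt.
apply: contra bJ => jN; apply/imsetP.
by exists ((pi^-1)%g b); rewrite ?inE// permKV.
Qed.

(* No summability condition is needed, in contrast with r < 0, for which it
   fails on +oo + -oo = -oo. *)
Lemma mule_sumr_ge0 (R : realType) (I : Type) (s : seq I) (P : pred I)
    (r : R) (F : I -> \bar R) : 0 <= r ->
  (r%:E * \sum_(i <- s | P i) F i = \sum_(i <- s | P i) r%:E * F i)%E.
Proof.
move=> r0; apply: (big_morph (fun x => r%:E * x)%E); last exact: mule0.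
have [->|rn0] := eqVneq r 0; first by move=> x y; rewrite !mul0e adde0.
have rp : (0 < r%:E)%E by rewrite lte_fin lt_neqAle eq_sym rn0.
by move=> [x| |] [y| |] //=; rewrite ?(gt0_muley rp) ?(gt0_muleNy rp)//;
  rewrite -?EFinD -?EFinM ?mulrDr.
Qed.

Section integral_finite_range.
Context d (Omega : measurableType d) (R : realType).
Context (mu : {measure set Omega -> \bar R}) (T : finType).
Variables (D : set Omega) (Z : Omega -> T).
Hypothesis mZ : forall t, measurable (D `&` Z @^-1` [set t]).

Lemma measurable_fun_finite_range (h : T -> \bar R) :
  measurable_fun D (fun x => h (Z x)).
Proof.
move=> _ B _.
rewrite (_ : _ `&` _ =
    \bigcup_(t in [set t | B (h t)]) (D `&` Z @^-1` [set t])); last first.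
  apply/seteqP; split=> [x [Dx Bx]|x [t Bt [Dx /= Zx]]]; first by exists (Z x).
  by split=> //=; rewrite Zx.
by apply: fin_bigcup_measurable => //; exact: finite_finset.
Qed.

(** The fibres of [Z] partition [D] into finitely many measurable pieces, on each of which the
    integrand is constant. *)
Lemma ge0_integral_finite_range (h : T -> \bar R) :
  (forall t, (0 <= h t)%E) ->
  (\int[mu]_(x in D) h (Z x) =
   \sum_(t : T) h t * mu (D `&` Z @^-1` [set t]))%E.
Proof.
move=> h0; pose F t := D `&` Z @^-1` [set t].
have DE : D = \big[setU/set0]_(t <- index_enum T) F t.
  rewrite -bigcup_seq; apply/seteqP; split=> [x Dx|x [t _ []]//].
  by exists (Z x) => //=; exact: mem_index_enum.
rewrite [X in integral _ X]DE ge0_integral_bigsetU//=.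
- apply: eq_bigr => t _; rewrite -integral_cst; last exact: mZ.
  by apply: eq_integral => x /set_mem[_ /= ->].
- exact: index_enum_uniq.
- exact: trivIset_preimage1_in.
- by rewrite -DE; exact: measurable_fun_finite_range.
Qed.

(* Valid even when h takes both infinite values on sets of positive measure:
   both sides are then -oo, because +oo + -oo = -oo. *)
Lemma integral_finite_range (h : T -> \bar R) :
  (\int[mu]_(x in D) h (Z x) =
   \sum_(t : T) h t * mu (D `&` Z @^-1` [set t]))%E.
Proof.
rewrite integralE.
rewrite (funepos_comp h Z) (funeneg_comp h Z) /comp.
rewrite (ge0_integral_finite_range (h := h^\+%E))//.
rewrite (ge0_integral_finite_range (h := h^\-%E))//.
rewrite -sumeN; last first.
  by move=> s t _ _; apply: ge0_adde_def; rewrite inE mule_ge0.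
rewrite -big_split/=; apply: eq_bigr => t _.
(* At each [t] one of the positive and negative parts vanishes, so no difference of infinities
   arises within a term. *)
have [ht|/ltW ht] := leP 0%E (h t).
  rewrite (ge0_funeposE (D := [set t])) ?inE//; last by move=> _ ->.
  rewrite (ge0_funenegE (D := [set t])) ?inE//; last by move=> _ ->.
  by rewrite mul0e oppe0 adde0.
rewrite (le0_funeposE (D := [set t])) ?inE//; last by move=> _ ->.
rewrite (le0_funenegE (D := [set t])) ?inE//; last by move=> _ ->.
by rewrite mul0e add0e mulNe oppeK.
Qed.

End integral_finite_range.

(** Both integrals are the same finite sum over labels, the right one by taking [Z] to be the
    identity. *)
Lemma integral_label (R : realType) (m : nat) d (Omega : measurableType d)
    (P : probability Omega R) (X : {RV P >-> label m}) (theta : simplex R m)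
    (f : label m -> \bar R) :
  (forall A, distribution P X A = label_prob theta A) ->
  (\int[P]_w f (X w) = \int[label_prob theta]_k f k)%E.
Proof.
move=> hX; rewrite integral_finite_range//; last first.
  by move=> k; apply: measurable_funPT.
rewrite (integral_finite_range (label_prob theta) (Z := idfun))//.
by apply: eq_bigr => k _; rewrite !setTI; congr *%E; exact: hX.
Qed.

Section expected_AULC_prefix_sums.
Context (R : realType) (m n : nat) (l : simplex R m -> label m -> \bar R).
Variable thetah : 'I_n -> simplex R m.

(** A finite codomain lets [integral_finite_range] apply; on [0, 1] the floor is at most [n], so
    [inord] does not alter it. *)
Let accepted (a : R) : 'I_n.+1 := inord (Num.truncn (a * n%:R)).

Let level (N : 'I_n.+1) : set R := `[0, 1] `&` accepted @^-1` [set N].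

Let acceptedE (a : R) : `[0, 1]%classic a ->
  accepted a = Num.truncn (a * n%:R) :> nat.
Proof.
rewrite /= in_itv/= => /andP[a0 a1]; rewrite /accepted inordK// ltnS.
by rewrite truncn_le_nat (le_lt_trans (ler_piMl _ a1))// ltr_nat.
Qed.

Let measurable_level (N : 'I_n.+1) : measurable (level N).
Proof.
have -> : level N =
    `[0, 1] `&` (fun a : R => a * n%:R) @^-1` `[N%:R, N.+1%:R[%classic.
  apply/seteqP; split=> a [a01 /= aN]; (split; first exact: a01) => /=;
    have an0 : 0 <= a * n%:R by
      move: a01; rewrite /= in_itv/= => /andP[a0 _]; rewrite mulr_ge0.
  - by rewrite in_itv/= -truncn_eq// -acceptedE// aN.
  - by apply/val_inj => /=; apply/eqP; rewrite acceptedE// truncn_eq.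
by apply: measurable_funM => //; exact: measurable_id.
Qed.

(** The length of the level set times the averaging factor; it is 0 at [N] = 0, where the inverse is
    0. *)
Let weight (N : 'I_n.+1) : R := fine (lebesgue_measure (level N)) / N%:R.

Let weight_ge0 N : 0 <= weight N.
Proof. by rewrite mulr_ge0 ?invr_ge0// fine_ge0. Qed.

Let lebesgue_levelK N :
  (fine (lebesgue_measure (level N)))%:E = lebesgue_measure (level N).
Proof.
rewrite fineK// ge0_fin_numE//.
apply: (@le_lt_trans _ _ (lebesgue_measure (`[0, 1]%classic : set R))).
  apply: le_measure; rewrite ?inE; [exact: measurable_level| |exact: subIsetl].
  exact: measurable_itv.
by rewrite lebesgue_measure_itv/= lte_fin ltr01 -EFinB ltry.
Qed.

Let AULCE (y : 'I_n -> label m) (s : 'S_n) :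
  AULC l thetah y s = (\sum_(N < n.+1) (weight N)%:E *
    \sum_(j < n | (j < N)%N) l (thetah (s j)) (y (s j)))%E.
Proof.
pose h (N : 'I_n.+1) : \bar R := ((N%:R^-1)%:E *
  \sum_(j < n | (j < N)%N) l (thetah (s j)) (y (s j)))%E.
transitivity (\int[lebesgue_measure]_(a in `[0%R, 1%R]) h (accepted a))%E.
  apply: eq_integral => a /set_mem a01.
  by rewrite /selective_loss /h acceptedE.
rewrite (integral_finite_range lebesgue_measure measurable_level h).
apply: eq_bigr => N _.
transitivity (h N * (fine (lebesgue_measure (level N)))%:E)%E.
  by congr *%E; exact/esym/lebesgue_levelK.
by rewrite /h muleC muleA -EFinM.
Qed.

(** The weights are chosen before [s], so two orderings can be compared separately for each [N]. *)
Lemma expected_AULC_prefix_sums : exists2 w : 'I_n.+1 -> R,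
  forall N, 0 <= w N &
  forall (theta : 'I_n -> simplex R m) d (Omega : measurableType d)
    (P : probability Omega R) (Y : 'I_n -> {RV P >-> label m}),
  (forall i A, distribution P (Y i) A = label_prob (theta i) A) ->
  forall s : 'S_n, expected_AULC l thetah Y s =
    (\sum_(N < n.+1) (w N)%:E *
      \sum_(j < n | (j < N)%N) expected_loss l (thetah (s j)) (theta (s j)))%E.
Proof.
exists weight => // theta d Omega P Y hY s.
(* All labels are gathered into one variable with finite range, so that an expectation becomes a
   finite sum over label vectors. *)
pose Z (w : Omega) : {ffun 'I_n -> label m} := [ffun i => Y i w].
have mZ t : measurable ([set: Omega] `&` Z @^-1` [set t]).
  rewrite setTI (_ : _ @^-1` _ =
      \bigcap_(i in [set: 'I_n]) (Y i @^-1` [set t i])).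
    apply: fin_bigcap_measurable => [|i _]; first exact: finite_finset.
    by rewrite -[_ @^-1` _]setTI; apply: measurable_funPT.
  apply/seteqP; split=> [x /= <- i _|x Yt]; first by rewrite /= ffunE.
  by apply/ffunP => i; rewrite ffunE; exact: Yt.
have EZ (h : {ffun 'I_n -> label m} -> \bar R) :
    (\int[P]_w h (Z w) = \sum_t (fine (P (Z @^-1` [set t])))%:E * h t)%E.
  rewrite integral_finite_range//; apply: eq_bigr => t _.
  rewrite setTI fineK 1?muleC//; apply: fin_num_measure.
  by rewrite -[X in measurable X]setTI.
transitivity (\int[P]_w AULC l thetah (Z w) s)%E.
  apply: eq_integral => w _; congr AULC; apply/funext => i.
  by rewrite ffunE.
rewrite (EZ (fun t => AULC l thetah t s)).
(* The probabilities of label vectors are nonnegative reals, so they distribute over the sum over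
   [N]; the same is done below for the sum over instances. *)
under eq_bigr do rewrite AULCE mule_sumr_ge0 ?fine_ge0//.
rewrite exchange_big/=; apply: eq_bigr => N _.
under eq_bigr do rewrite muleCA.
rewrite -mule_sumr_ge0//; congr (_ * _)%E.
under [LHS]eq_bigr do rewrite mule_sumr_ge0 ?fine_ge0//.
rewrite exchange_big/=; apply: eq_bigr => j _.
(* Read backwards, [EZ] gives the expectation of a function of one coordinate, which depends only on
   the marginal law in [hY]. *)
rewrite -(EZ (fun t => l (thetah (s j)) (t (s j)))).
rewrite -[RHS](integral_label (l (thetah (s j))) (hY (s j))).
by apply: eq_integral => w _; rewrite ffunE.
Qed.

End expected_AULC_prefix_sums.

Theorem proposition4p1 (R : realType) (m n : nat)
  (l : simplex R m -> label m -> \bar R) (hl : loss_function l)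
  (thetah theta : 'I_n -> simplex R m)
  (d : measure_display) (Omega : measurableType d) (P : probability Omega R)
  (Y : 'I_n -> {RV P >-> label m})
  (hY : forall (i : 'I_n) (A : set (label m)),
      distribution P (Y i) A = label_prob (theta i) A)
  (pi : 'S_n)
  (hpi : forall i j : 'I_n, (i <= j)%N ->
      (expected_loss l (thetah (pi i)) (theta (pi i)) <=
       expected_loss l (thetah (pi j)) (theta (pi j)))%E) :
  forall sigma : 'S_n,
    (expected_AULC l thetah Y pi <= expected_AULC l thetah Y sigma)%E.
Proof.
move=> sigma; have [w w0 E] := expected_AULC_prefix_sums l thetah.
rewrite !(E _ _ _ _ _ hY); apply: lee_sum => N _.
apply: lee_wpmul2l; first by rewrite lee_fin.
exact: (lee_sum_prefix (e := fun i => expected_loss l (thetah i) (theta i))).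
Qed.
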